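(* Let $\diamond$ be one of the binary operations restrict, permit, nonsuperset, or nonsubset. Then there exist, for each positive integer $m$, a finite ground set $U_m$ with $|U_m|=O(m^2)$, a total order $<_m$ on $U_m$, and families $\mathcal{F}_m,\mathcal{G}_m$ of subsets of $U_m$ such that $Z_{<_m}(\mathcal{F}_m)+Z_{<_m}(\mathcal{G}_m)=O(m^4)$ and $Z_{<_m}(\mathcal{F}_m\diamond\mathcal{G}_m)=\Omega(2^{m}/\mathrm{poly}(m))$, i.e. $Z_{<_m}(\mathcal{F}_m\diamond\mathcal{G}_m)\ge 2^{m}/p(m)$ for some polynomial $p$ and all sufficiently large $m$.
   Context: A family of sets is a set of subsets of a finite ground set $U$. Restrict: $\{F\in\mathcal{F}\mid\exists G\in\mathcal{G}: G\subseteq F\}$. Permit: $\{F\in\mathcal{F}\mid\exists G\in\mathcal{G}: F\subseteq G\}$. Nonsuperset: $\{F\in\mathcal{F}\mid\forall G\in\mathcal{G}: G\not\subseteq F\}$. Nonsubset: $\{F\in\mathcal{F}\mid\forall G\in\mathcal{G}: F\not\subseteq G\}$ (each is an operation $\mathcal{F}\diamond\mathcal{G}$). A zero-suppressed binary decision diagram (ZDD) with respect to a total order $<$ on $U$ is a rooted DAG with two terminal nodes $\top,\bot$ and internal nodes $\mathtt{n}$, each with a label $\mathsf{lb}(\mathtt{n})\in U$ and children $\mathsf{lo}(\mathtt{n}),\mathsf{hi}(\mathtt{n})$, labels strictly increasing along arcs. A node represents: $\{\emptyset\}$ if $\top$, $\emptyset$ if $\bot$, and $\mathcal{F}_{\mathsf{lo}(\mathtt{n})}\cup\{\{\mathsf{lb}(\mathtt{n})\}\cup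 S\mid S\in\mathcal{F}_{\mathsf{hi}(\mathtt{n})}\}$ otherwise; the ZDD represents the family of its root. The reduced ZDD (obtained by merging nodes with identical label and children and deleting nodes whose hi-child is $\bot$) is the unique smallest ZDD for the family and order; $Z_<(\mathcal{F})$ is its number of nodes. Asymptotics are as $m\to\infty$. *)

(* Defs.v *)
From HB Require Import structures.
From mathcomp Require Import all_boot all_order all_algebra.
From Stdlib Require Import IndefiniteDescription.

Set Implicit Arguments.
Unset Strict Implicit.
Unset Printing Implicit Defensive.

Import Order.TTheory.

Section FamilyOperations.
Variable U : finType.
Implicit Types F G : {set {set U}}.

Definition restrict F G := [set A in F | [exists B in G, B \subset A]].
Definition permit F G := [set A in F | [exists B in G, A \subset B]].
Definition nonsuperset F G := [set A in F | [forall B in G, ~~ (B \subset A)]].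
Definition nonsubset F G := [set A in F | [forall B in G, ~~ (A \subset B)]].

End FamilyOperations.

Inductive family_op := Restrict | Permit | Nonsuperset | Nonsubset.

Definition apply_op (op : family_op) (U : finType) :
    {set {set U}} -> {set {set U}} -> {set {set U}} :=
  match op with
  | Restrict => @restrict U
  | Permit => @permit U
  | Nonsuperset => @nonsuperset U
  | Nonsubset => @nonsubset U
  end.

Inductive znode (N : Type) := ZTop | ZBot | ZNode of N.
Arguments ZTop {N}.
Arguments ZBot {N}.

(* The internal nodes form the finite type [inner]; the two terminals are the *)
(* first two constructors of [znode inner].                                   *)
Record diagram (U : Type) := Diagram {
  inner : finType;
  zlb : inner -> U;
  zlo : inner -> znode inner;
  zhi : inner -> znode inner;
  zroot : znode inner }.
Arguments inner {U}.
Arguments zroot {U}.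

Section ZDD.
Variables (disp : Order.disp_t) (U : finOrderType disp).
Implicit Types (D : diagram U) (F A B : {set {set U}}).

Definition label_increasing D :=
  forall n n' : inner D, zlo n = ZNode n' \/ zhi n = ZNode n' -> (zlb n < zlb n')%O.

Inductive reachable D : znode (inner D) -> Prop :=
| ReachRoot : reachable (zroot D)
| ReachLo n : reachable (ZNode n) -> reachable (zlo n)
| ReachHi n : reachable (ZNode n) -> reachable (zhi n).

(* Acyclicity is a consequence of [label_increasing]. *)
Definition is_zdd D :=
  label_increasing D /\ forall n : inner D, reachable (ZNode n).

Inductive node_family D : znode (inner D) -> {set {set U}} -> Prop :=
| FamTop : node_family ZTop [set set0]
| FamBot : node_family ZBot set0
| FamNode n A B :
    node_family (zlo n) A -> node_family (zhi n) B ->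
    node_family (ZNode n) (A :|: [set zlb n |: S | S in B]).

Definition represents D F := node_family (zroot D) F.

(* Neither reduction rule applies. *)
Definition reduced D :=
  (forall n : inner D, zhi n <> ZBot) /\
  (forall n n' : inner D, zlb n = zlb n' -> zlo n = zlo n' -> zhi n = zhi n' ->
     n = n').

(* Both terminals are always counted. *)
Definition num_nodes D := #|inner D| + 2.

(* Semantic subfamilies, used only to establish existence and uniqueness of   *)
(* the reduced diagram.                                                       *)
Definition minvar A : option U :=
  [pick x in cover A | [forall y in cover A, x <= y]%O].
Definition sublo (x : U) A := [set S in A | x \notin S].
Definition subhi (x : U) A := [set S :\ x | S in [set S in A | x \in S]].
Definition subfam_rel A B :=
  if minvar A is Some x then (B == sublo x A) || (B == subhi x A) else false.
Definition subfam F := {A : {set {set U}} | connect subfam_rel F A && minvar A}.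

Lemma minvarP A x :
  reflect (x \in cover A /\ forall S y, S \in A -> y \in S -> (x <= y)%O)
          (minvar A == Some x).
Proof.
rewrite /minvar; case: pickP => [z /andP[zA /forall_inP zmin]|nz].
- apply: (iffP eqP) => [[<-]|[xA xmin]].
    by split=> // S y SA yS; apply: zmin; apply/bigcupP; exists S.
  congr Some; apply/eqP; rewrite eq_le zmin //=.
  by case/bigcupP: zA => S SA zS; apply: xmin zS.
- apply: (iffP eqP) => // -[xA xmin].
  have := nz x; rewrite xA /= => /negP[]; apply/forall_inP => y /bigcupP[S].
  exact: xmin.
Qed.

Lemma minvarN A : minvar A = None -> A = set0 \/ A = [set set0].
Proof.
move=> mA; have cA : cover A = set0.
  apply/eqP/negPn/negP => /set0Pn[x0 x0A].
  have [x xA xmin] := arg_minP (fun x : U => x) x0A.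
  have /eqP : minvar A == Some x; last by rewrite mA.
  by apply/minvarP; split=> // S y SA yS; apply: xmin; apply/bigcupP; exists S.
have [->|/set0Pn[S SA]] := eqVneq A set0; [by left | right].
have s0 T : T \in A -> T = set0.
  by move=> TA; apply/eqP; rewrite -subset0 -cA; apply: bigcup_sup TA.
by apply/setP => T; rewrite inE; apply/idP/eqP => [/s0 //|->]; rewrite -(s0 S).
Qed.

Lemma sub_decomp x A : A = sublo x A :|: [set x |: S | S in subhi x A].
Proof.
apply/setP => S; rewrite !inE; apply/idP/idP => [SA|/orP[/andP[]//|]].
  rewrite SA /=; case: (boolP (x \in S)) => //= xS.
  apply/imsetP; exists (S :\ x); last by rewrite setD1K.
  by apply/imsetP; exists S; rewrite ?inE ?SA.
case/imsetP => T /imsetP[V]; rewrite inE => /andP[VA xV] -> ->.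
by rewrite setD1K.
Qed.

Lemma sub_node x A B :
  (forall S y, S \in A -> y \in S -> x < y)%O ->
  (forall S y, S \in B -> y \in S -> x < y)%O ->
  let C := A :|: [set x |: S | S in B] in
  [/\ sublo x C = A, subhi x C = B & B != set0 -> minvar C = Some x].
Proof.
move=> hA hB C.
have xA S : S \in A -> x \notin S.
  by move=> SA; apply/negP => /(hA _ _ SA); rewrite ltxx.
have xB S : S \in B -> x \notin S.
  by move=> SB; apply/negP => /(hB _ _ SB); rewrite ltxx.
split.
- apply/setP => S; rewrite !inE; apply/idP/idP => [|SA]; last by rewrite SA xA.
  case/andP => /orP[//|/imsetP[T _ ->]]; by rewrite setU11.
- apply/setP => S; apply/imsetP/idP => [[T]|SB].
    rewrite !inE => /andP[/orP[/xA/negP//|/imsetP[V VB ->]]] _ ->.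
    by rewrite setU1K // xB.
  exists (x |: S); last by rewrite setU1K // xB.
  by rewrite !inE eqxx andbT; apply/orP; right; apply/imsetP; exists S.
- case/set0Pn => S SB; apply/eqP/minvarP; split.
    apply/bigcupP; exists (x |: S); last exact: setU11.
    by rewrite inE; apply/orP; right; apply/imsetP; exists S.
  move=> T y; rewrite inE => /orP[TA /(hA _ _ TA)/ltW //|/imsetP[V VB ->]].
  by rewrite !inE => /orP[/eqP-> //|/(hB _ _ VB)/ltW].
Qed.

Section Ordered.
Variable D : diagram U.
Hypothesis incD : label_increasing D.

Lemma node_family_inv n C : @node_family D (ZNode n) C ->
  exists A B, [/\ C = A :|: [set zlb n |: S | S in B],
    @node_family D (zlo n) A & @node_family D (zhi n) B].
Proof.
by move=> H; inversion H as [| |m A B hA hB]; exists A, B.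
Qed.

Lemma node_family_top C : @node_family D ZTop C -> C = [set set0].
Proof. by move=> H; inversion H. Qed.

Lemma node_family_bot C : @node_family D ZBot C -> C = set0.
Proof. by move=> H; inversion H. Qed.

Lemma node_family_fun v A B :
  @node_family D v A -> @node_family D v B -> A = B.
Proof.
move=> H; elim: H B => [B /node_family_top //|B /node_family_bot //|].
move=> n A1 A2 _ IH1 _ IH2 B /node_family_inv[B1 [B2 [-> h1 h2]]].
by rewrite (IH1 _ h1) (IH2 _ h2).
Qed.

Lemma node_family_gt v A : @node_family D v A ->
  forall x, (forall n, v = ZNode n -> x < zlb n)%O ->
  forall S y, S \in A -> y \in S -> (x < y)%O.
Proof.
elim=> [x _ S y|x _ S y|n A1 A2 _ IH1 _ IH2 x xn S y].
- by rewrite inE => /eqP->; rewrite inE.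
- by rewrite inE.
have xlb := xn _ erefl; rewrite inE => /orP[|/imsetP[T TA ->]].
  apply: IH1 => n' en; apply: lt_trans xlb _; apply: incD; by left.
rewrite !inE => /orP[/eqP-> //|]; apply: IH2 TA => n' en.
by apply: lt_trans xlb _; apply: incD; right.
Qed.

Lemma node_familyE n C : @node_family D (ZNode n) C ->
  [/\ @node_family D (zlo n) (sublo (zlb n) C),
      @node_family D (zhi n) (subhi (zlb n) C),
      subhi (zlb n) C = set0 -> C = sublo (zlb n) C
    & subhi (zlb n) C != set0 -> minvar C = Some (zlb n)].
Proof.
case/node_family_inv => A [B [-> hA hB]].
have [] := @sub_node (zlb n) A B.
- by apply: node_family_gt hA _ _ => n' en; apply: incD; left.
- by apply: node_family_gt hB _ _ => n' en; apply: incD; right.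
move=> -> -> mC; split=> // ->; by rewrite imset0 setU0.
Qed.

Lemma node_family_minvar v A x : @node_family D v A -> minvar A = Some x ->
  exists n, [/\ @node_family D (ZNode n) A, zlb n = x,
    @node_family D (zlo n) (sublo x A) & @node_family D (zhi n) (subhi x A)].
Proof.
move=> H; elim: H x => [x /eqP/minvarP[]|x /eqP/minvarP[]|].
- by case/bigcupP => S; rewrite inE => /eqP->; rewrite inE.
- by case/bigcupP => S; rewrite inE.
move=> n A1 A2 h1 IH1 h2 _ x; have hC := FamNode h1 h2.
have [hl hh e0 e1] := node_familyE hC; move: hC hl hh e0 e1.
set C := A1 :|: _ => hC hl hh e0 e1 mC.
have [/e0 eC|/e1 mC'] := eqVneq (subhi (zlb n) C) set0.
  have e1A : A1 = C by rewrite [RHS]eC; apply: node_family_fun h1 hl.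
  by rewrite -e1A; apply: IH1; rewrite e1A.
by move: mC; rewrite mC' => -[<-]; exists n.
Qed.

Lemma subfam_node F A : represents D F -> connect subfam_rel F A ->
  exists v : znode (inner D), @node_family D v A.
Proof.
rewrite /represents => hF /connectP[p]; elim: p (zroot D) F hF => [|B p IH] v F hF /=.
  by move=> _ ->; exists v.
case/andP => + pB lA; rewrite /subfam_rel; case mF: (minvar F) => [x|//].
have [n [_ _ hl hh]] := node_family_minvar hF mF.
case/orP => /eqP eB; subst B; [exact: IH hl pB lA | exact: IH hh pB lA].
Qed.

Lemma card_subfam_le F : represents D F -> #|{: subfam F}| <= #|inner D|.
Proof.
move=> hF.
have /fin_all_exists[f hf] (A : subfam F) :
    exists n : inner D, @node_family D (ZNode n) (val A).
  case: A => A /= /andP[cA]; case mA: (minvar A) => [x|//] _.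
  have [v hv] := subfam_node hF cA.
  by have [n [hn _ _ _]] := node_family_minvar hv mA; exists n.
apply: (@leq_card _ _ f) => A B eAB; apply: val_inj.
by apply: node_family_fun (hf A) _; rewrite eAB.
Qed.

Section Reduced.
Hypothesis redD : reduced D.

Lemma reduced_set0 v : @node_family D v set0 -> v = ZBot.
Proof.
suff gen A : @node_family D v A -> A = set0 -> v = ZBot by move/gen; apply.
elim=> // [/setP/(_ set0)|n A1 A2 _ _ _ IH /eqP]; first by rewrite !inE eqxx.
rewrite setU_eq0 => /andP[_ /eqP e0]; case: (redD.1 n); apply: IH.
apply/eqP/negPn/negP => /set0Pn[S SA].
by move/setP/(_ (zlb n |: S)): e0; rewrite imset_f // inE.
Qed.

Lemma reduced_node n A : @node_family D (ZNode n) A -> minvar A = Some (zlb n).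
Proof.
case/node_familyE => _ hh _; apply; apply/eqP => h0.
by rewrite h0 in hh; move/reduced_set0: hh; apply: redD.1.
Qed.

Lemma reduced_inj v w A : @node_family D v A -> @node_family D w A -> v = w.
Proof.
move=> H; elim: H w => [w|w|n A1 A2 h1 IH1 h2 IH2 w].
- case: w => // [/node_family_bot/setP/(_ set0)|n /reduced_node].
    by rewrite !inE eqxx.
  move/eqP/minvarP => -[/bigcupP[S]].
  by rewrite inE => /eqP->; rewrite inE.
- by move/reduced_set0 ->.
have hC := FamNode h1 h2; move: (hC); set C := A1 :|: _ => {}hC.
have mC := reduced_node hC; have [hl hh _ _] := node_familyE hC.
have eA1 := node_family_fun h1 hl; have eA2 := node_family_fun h2 hh.
case: w => [/node_family_top eC|/node_family_bot eC|n' hw].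
- move/eqP/minvarP: mC => -[/bigcupP[S]].
  by rewrite eC inE => /eqP->; rewrite inE.
- by move/eqP/minvarP: mC => -[/bigcupP[S]]; rewrite eC inE.
have mC' := reduced_node hw; have [hl' hh' _ _] := node_familyE hw.
have elb : zlb n = zlb n' by move: mC'; rewrite mC => -[].
rewrite -elb in hl' hh'; congr ZNode; apply: redD.2 => //.
  by apply: IH1; rewrite eA1.
by apply: IH2; rewrite eA2.
Qed.

Lemma reduced_reach F v : represents D F -> @reachable D v ->
  exists2 A, @node_family D v A & connect subfam_rel F A.
Proof.
move=> hF; elim=> [|n _ [A hA cA]|n _ [A hA cA]]; first by exists F.
- have [hl _ _ _] := node_familyE hA; exists (sublo (zlb n) A) => //.
  apply: connect_trans cA (connect1 _).
  by rewrite /subfam_rel (reduced_node hA) eqxx.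
- have [_ hh _ _] := node_familyE hA; exists (subhi (zlb n) A) => //.
  apply: connect_trans cA (connect1 _).
  by rewrite /subfam_rel (reduced_node hA) eqxx orbT.
Qed.

Lemma card_subfam_ge F : (forall n : inner D, @reachable D (ZNode n)) ->
  represents D F -> #|inner D| <= #|{: subfam F}|.
Proof.
move=> rD hF.
have /fin_all_exists[f hf] (n : inner D) :
    exists A : subfam F, @node_family D (ZNode n) (val A).
  have [A hA cA] := reduced_reach hF (rD n).
  have PA : connect subfam_rel F A && minvar A by rewrite cA (reduced_node hA).
  by exists (Sub A PA).
apply: (@leq_card _ _ f) => n n' enn.
have [] // : ZNode n = ZNode n'.
by apply: reduced_inj (hf n) _; rewrite enn.
Qed.

End Reduced.
End Ordered.

Section Canonical.
Variable F : {set {set U}}.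

Definition can_node A : znode (subfam F) :=
  if A == set0 then ZBot
  else if (insub A : option (subfam F)) is Some n then ZNode n else ZTop.

Lemma can_label (n : subfam F) : {x | minvar (val n) = Some x}.
Proof. by case: n => A /= /andP[_]; case: (minvar A) => // x _; exists x. Qed.

Definition can_lb n := sval (can_label n).

Definition can_zdd : diagram U :=
  @Diagram U (subfam F) can_lb
    (fun n => can_node (sublo (can_lb n) (val n)))
    (fun n => can_node (subhi (can_lb n) (val n)))
    (can_node F).

Lemma can_lbP n : minvar (val n) = Some (can_lb n).
Proof. exact: svalP (can_label n). Qed.

Lemma can_nodeK A n : can_node A = ZNode n -> val n = A.
Proof.
by rewrite /can_node; case: ifP => // _; case: insubP => // m _ <- [<-].
Qed.

Lemma can_node_val (n : subfam F) : can_node (val n) = ZNode n.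
Proof.
rewrite /can_node valK; case: eqP => // n0.
have /eqP/minvarP[/bigcupP[S]] := can_lbP n; by rewrite n0 inE.
Qed.

Lemma can_connect (n : subfam F) A :
  (A == sublo (can_lb n) (val n)) || (A == subhi (can_lb n) (val n)) ->
  connect subfam_rel F A.
Proof.
move=> h; have /andP[cn _] := valP n; apply: connect_trans cn (connect1 _).
by rewrite /subfam_rel can_lbP.
Qed.

Lemma can_node_inj A B : connect subfam_rel F A -> connect subfam_rel F B ->
  can_node A = can_node B -> A = B.
Proof.
move=> cA cB; rewrite /can_node.
case: eqP => [->|A0]; case: eqP => [-> //|B0]; try by case: insubP.
case: insubP => [n _ <-|nA]; case: insubP => [m _ <-|nB] //; first by case=> ->.
move: nA nB; rewrite cA cB /=.
case mA: (minvar A) => [//|] _; case mB: (minvar B) => [//|] _ _.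
by case: (minvarN mA) A0 => -> //; case: (minvarN mB) B0 => -> //.
Qed.

Lemma subhi_neq0 x A : minvar A = Some x -> subhi x A != set0.
Proof.
move/eqP/minvarP => -[/bigcupP[S SA xS] _]; apply/set0Pn; exists (S :\ x).
by apply/imsetP; exists S; rewrite ?inE ?SA.
Qed.

Lemma can_increasing : label_increasing can_zdd.
Proof.
move=> n m /= h; have /eqP/minvarP[_ nmin] := can_lbP n.
have /eqP/minvarP[/bigcupP[S Sm mS] _] := can_lbP m.
case: h => /can_nodeK em; rewrite em in Sm.
  move: Sm; rewrite inE => /andP[SA nS]; rewrite lt_neqAle (nmin S) // andbT.
  by apply: contraNneq nS => ->.
case/imsetP: Sm mS => T; rewrite inE => /andP[TA _] ->.
by rewrite !inE lt_neqAle eq_sym => /andP[-> mT]; rewrite (nmin T).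
Qed.

Lemma can_family A : connect subfam_rel F A -> @node_family can_zdd (can_node A) A.
Proof.
have [k] := ubnP (\sum_(S in A) #|S|.+1); elim: k A => // k IH A.
rewrite ltnS => leA cA; case mA: (minvar A) => [x|]; last first.
  rewrite /can_node; case: eqP => [->|A0]; first exact: FamBot.
  case: insubP => [n|_]; first by rewrite mA andbF.
  by case: (minvarN mA) A0 => -> // _; apply: FamTop.
have PA : connect subfam_rel F A && minvar A by rewrite cA mA.
pose n : subfam F := Sub A PA; have vn : val n = A by [].
have lbn : can_lb n = x by move: (can_lbP n); rewrite vn mA => -[].
have -> : can_node A = ZNode n by rewrite -vn can_node_val.
rewrite [X in node_family _ X](sub_decomp x A) -lbn.
have : exists2 S, S \in A & x \in S.
  by move/eqP/minvarP: mA => -[/bigcupP[S]]; exists S.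
case=> S0 S0A xS0.
have sz : \sum_(S in A) #|S|.+1 = \sum_(S in sublo x A) #|S|.+1 +
    \sum_(S in [set S in A | x \in S]) #|S|.+1.
  rewrite (bigID (fun S : {set U} => x \notin S)) /=; congr (_ + _);
  by apply: eq_bigl => S; rewrite !inE ?negbK.
have S0i : S0 \in [set S in A | x \in S] by rewrite inE S0A.
apply: (@FamNode can_zdd n); rewrite /= lbn.
- apply: IH; last by apply: (can_connect (n := n)); rewrite lbn eqxx.
  apply: leq_trans leA; rewrite sz -[X in X < _]addn0 ltn_add2l.
  by rewrite (bigD1 S0).
- apply: IH; last by apply: (can_connect (n := n)); rewrite lbn eqxx orbT.
  apply: leq_trans leA; rewrite sz; apply: leq_trans (leq_addl _ _).
  rewrite /subhi big_imset /=; last first.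
    move=> S T; rewrite !inE => /andP[_ xS] /andP[_ xT] eST.
    by rewrite -(setD1K xS) eST setD1K.
  rewrite (bigD1 S0) //= [X in _ < X](bigD1 S0) //=.
  rewrite -addSn leq_add //; first by rewrite [X in _ < X.+1](cardsD1 x S0) xS0.
  by apply: leq_sum => S _; rewrite ltnS subset_leq_card // subsetDl.
Qed.

Lemma can_is_zdd : is_zdd can_zdd.
Proof.
split; first exact: can_increasing.
move=> n; rewrite -can_node_val; have /andP[] := valP n.
move: (val n) => A /connectP[p]; elim/last_ind: p A => [A _ -> _|p B IH A].
  exact: ReachRoot.
rewrite rcons_path last_rcons => /andP[pF sB] -> _.
move: sB; rewrite /subfam_rel; set C := last F p; case mC: (minvar C) => [x|//].
have cC : connect subfam_rel F C by apply/connectP; exists p.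
have PC : connect subfam_rel F C && minvar C by rewrite cC mC.
have rC : @reachable can_zdd (can_node C) by apply: IH; rewrite // mC.
pose n' : subfam F := Sub C PC.
have lbn : can_lb n' = x by move: (can_lbP n'); rewrite mC => -[].
rewrite -[C]/(val n') can_node_val in rC.
case/orP => /eqP ->; rewrite -lbn.
  exact: (@ReachLo can_zdd n' rC).
exact: (@ReachHi can_zdd n' rC).
Qed.

Lemma can_reduced : reduced can_zdd.
Proof.
split=> [n /=|n n' /= elb el eh].
  rewrite /can_node (negPf (subhi_neq0 (can_lbP n))); by case: insubP.
have eL : sublo (can_lb n) (val n) = sublo (can_lb n) (val n').
  apply: can_node_inj; last by rewrite el elb.
    by apply: (can_connect (n := n)); rewrite eqxx.
  by apply: (can_connect (n := n')); rewrite elb eqxx.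
have eH : subhi (can_lb n) (val n) = subhi (can_lb n) (val n').
  apply: can_node_inj; last by rewrite eh elb.
    by apply: (can_connect (n := n)); rewrite eqxx orbT.
  by apply: (can_connect (n := n')); rewrite elb eqxx orbT.
apply: val_inj; rewrite [LHS](sub_decomp (can_lb n)) eL eH.
by rewrite -sub_decomp.
Qed.

End Canonical.

Lemma reduced_zdd_exists F :
  exists D, [/\ is_zdd D, reduced D & represents D F].
Proof.
exists (can_zdd F); split; [exact: can_is_zdd|exact: can_reduced|].
exact: can_family (connect0 _ _).
Qed.

Definition reduced_zdd F : diagram U :=
  proj1_sig (constructive_indefinite_description _ (reduced_zdd_exists F)).

Definition Zsize F : nat := num_nodes (reduced_zdd F).

Lemma reduced_zddP F :
  [/\ is_zdd (reduced_zdd F), reduced (reduced_zdd F)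
    & represents (reduced_zdd F) F].
Proof. by rewrite /reduced_zdd; case: constructive_indefinite_description. Qed.

Lemma Zsize_min F D : is_zdd D -> represents D F -> Zsize F <= num_nodes D.
Proof.
move=> [incD _] hD; have [[incR rR] redR hR] := reduced_zddP F.
rewrite leq_add2r; apply: leq_trans (card_subfam_le incD hD).
exact: card_subfam_ge.
Qed.

Lemma Zsize_reduced F D :
  is_zdd D -> reduced D -> represents D F -> num_nodes D = Zsize F.
Proof.
move=> zD redD hD; apply/eqP; rewrite eqn_leq Zsize_min // andbT.
have [[incR rR] redR hR] := reduced_zddP F; have [incD rD] := zD.
rewrite leq_add2r; apply: leq_trans (card_subfam_le incR hR).
exact: card_subfam_ge.
Qed.

End ZDD.

(* Main.v *)
Require Import Defs.
From mathcomp Require Import all_boot all_order all_algebra.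
From mathcomp Require Import zify.
Import Order.TTheory GRing.Theory Num.Theory.

(** The nodes of the reduced ZDD of a family are its distinct cofactors: fix
    which elements of an initial segment [D] belong to a set, and collect the
    possible remainders.  The power set has one cofactor per initial segment,
    and a family of [k] sets has at most [k] nonempty ones for each.

    Take [2m] elements [x_1 < ... < x_m < y_1 < ... < y_m], let [F] be the power
    set and let [G] consist of the [m] pairs [{x_i, y_i}] (restrict,
    nonsuperset) or of their complements (permit, nonsubset).  Restricting
    yields the sets containing some pair; a subset [X] of the [x_i] can be read
    off its cofactor, since [x_i] is in [X] iff [{y_i}] is in the cofactor.  So
    the result has [2 ^ m] cofactors.  The other operations are analogous. *)

(** * Cofactors as nodes of the reduced ZDD *)

Section Cofactors.
Set Implicit Arguments.
Unset Strict Implicit.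
Variables (disp : Order.disp_t) (U : finOrderType disp).
Implicit Types (x y : U) (S X D : {set U}) (F A : {set {set U}}).

Lemma disjoint_setU1l x S D :
  [disjoint x |: S & D] = (x \notin D) && [disjoint S & D].
Proof. by rewrite !disjoints_subset subUset sub1set inE. Qed.

Lemma disjoint_setU1r x S D :
  [disjoint S & x |: D] = (x \notin S) && [disjoint S & D].
Proof. by rewrite disjoint_sym disjoint_setU1l disjoint_sym. Qed.

(* Meaningful only for [X \subset D]. *)
Definition cofactor D X F := [set S in powerset (~: D) | X :|: S \in F].

Lemma in_cofactor D X F S :
  (S \in cofactor D X F) = [disjoint S & D] && (X :|: S \in F).
Proof. by rewrite !inE disjoints_subset. Qed.

Lemma cofactor0 F : cofactor set0 set0 F = F.
Proof. by apply/setP => S; rewrite !inE setC0 subsetT set0U. Qed.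

Lemma sublo_cofactor D X F x :
  sublo x (cofactor D X F) = cofactor (x |: D) X F.
Proof.
by apply/setP => S; rewrite inE !in_cofactor disjoint_setU1r andbC andbA.
Qed.

Lemma subhi_cofactor D X F x : x \notin D ->
  subhi x (cofactor D X F) = cofactor (x |: D) (x |: X) F.
Proof.
move=> xD; apply/setP => S; rewrite in_cofactor.
apply/imsetP/andP => [[T]|[dS XS]].
  rewrite inE in_cofactor => /andP[/andP[dT XT] xT] ->; split; last first.
    by rewrite setUAC setD1K // setUC.
  by rewrite disjoint_setU1r !inE eqxx (disjointWl (subsetDl _ _) dT).
move: dS; rewrite disjoint_setU1r => /andP[xS dS].
exists (x |: S); last by rewrite setU1K.
rewrite inE in_cofactor setU11 andbT setUCA setUA XS andbT.
by rewrite disjoint_setU1l xD.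
Qed.

(** When no remainder meets [D'], declaring the rest of [D'] absent loses nothing. These are the
    levels that an arc of the diagram skips. *)
Lemma cofactor_widen D D' X F : D \subset D' ->
  (forall S, S \in cofactor D X F -> [disjoint S & D']) ->
  cofactor D X F = cofactor D' X F.
Proof.
move=> sD dD; apply/setP => S; apply/idP/idP => [SF|].
  by rewrite in_cofactor dD //; move: SF; rewrite in_cofactor => /andP[].
by rewrite !in_cofactor => /andP[dS ->]; rewrite (disjointWr sD dS).
Qed.

Definition down_closed D := forall x y, x \in D -> (y <= x)%O -> y \in D.

(** Drop the largest element [x] of [D]; the cofactor for the smaller segment is reachable by
    induction. Either it branches on [x] and the wanted cofactor is a child, or [x] occurs in none
    of its members and the wanted cofactor is the same family. *)
Lemma cofactor_connect F D X : down_closed D -> X \subset D ->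
  cofactor D X F != set0 -> connect (@subfam_rel _ U) F (cofactor D X F).
Proof.
have [k] := ubnP #|D|; elim: k D X => // k IH D X; rewrite ltnS => leD dD sX nz.
have [D0|/set0Pn[x0 x0D]] := eqVneq D set0.
  by move: sX; rewrite D0 subset0 => /eqP->; rewrite cofactor0.
have [x xD xmax] : exists2 x, x \in D & forall y, y \in D -> (y <= x)%O.
  by have [x xD xmax] := arg_maxP (fun x : U => x) x0D; exists x.
have eD := setD1K xD; set D' := D :\ x in eD.
have xD' : x \notin D' by rewrite !inE eqxx.
have leD' : #|D'| < k by apply: leq_trans leD; rewrite (cardsD1 x D) xD.
have dD' : down_closed D'.
  move=> y z; rewrite !inE => /andP[yx yD] zy; rewrite (dD _ _ yD zy) andbT.
  apply: contraNneq yx => ezx; rewrite eq_le -{2}ezx zy andbT.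
  exact: xmax.
have ltD' y : y \notin D' -> (x <= y)%O.
  rewrite !inE negb_and negbK => /orP[/eqP-> //|]; apply: contraR.
  by rewrite -ltNge => /ltW; apply: dD.
have eX : x \notin X -> X :\ x = X.
  by move=> xX; apply/setDidPl; rewrite disjoint_sym disjoints1.
have sX' : X :\ x \subset D' by apply: setSD.
pose A := cofactor D' (X :\ x) F.
have nzA : A != set0.
  case/set0Pn: nz => S; rewrite in_cofactor => /andP[dS XS].
  have xS : x \notin S by rewrite (disjointFl dS xD).
  apply/set0Pn; case: (boolP (x \in X)) => xX.
    exists (x |: S); rewrite in_cofactor setUCA setUA setD1K // XS andbT.
    by rewrite disjoint_setU1l xD' (disjointWr (subsetDl _ _) dS).
  by exists S; rewrite in_cofactor eX // XS (disjointWr (subsetDl _ _) dS).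
have cA : connect (@subfam_rel _ U) F A by apply: IH.
have [xA|xA] := boolP (x \in cover A).
  have mA : minvar A = Some x.
    apply/eqP/minvarP; split=> // S y; rewrite in_cofactor => /andP[dS _] yS.
    by apply: ltD'; rewrite (disjointFr dS yS).
  apply: connect_trans cA (connect1 _); rewrite /subfam_rel mA.
  rewrite sublo_cofactor subhi_cofactor // eD.
  have [xX|xX] := boolP (x \in X); first by rewrite setD1K // eqxx orbT.
  by rewrite eX // eqxx.
have eA : A = cofactor D (X :\ x) F.
  apply: cofactor_widen => [|S SA]; first exact: subsetDl.
  have xS : x \notin S.
    by apply: contra xA => xS; apply/bigcupP; exists S.
  by rewrite -eD disjoint_setU1r xS; move: SA; rewrite in_cofactor => /andP[].
have [xX|xX] := boolP (x \in X); last first.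
  by rewrite -(eX xX) -eA.
(* With [x] in [X] the cofactor would come from the members of [A] containing [x], and there are
   none. *)
case/negP: nz; rewrite -eD -(setD1K xX) -subhi_cofactor // -/A.
apply/eqP/setP => S; rewrite inE; apply/imsetP => -[T].
by rewrite inE => /andP[TA xT] _; case/negP: xA; apply/bigcupP; exists T.
Qed.

(** [None] encodes the empty segment, which belongs to the root. *)
Definition cut (o : option U) := [set y | if o is Some x then (y <= x)%O else false].

Lemma connect_cofactor F A : connect (@subfam_rel _ U) F A ->
  exists o X, X \subset cut o /\ A = cofactor (cut o) X F.
Proof.
case/connectP => p; elim/last_ind: p A => [A _ ->|p B IH A].
  exists None, set0; rewrite sub0set; split=> //.
  have -> : cut None = set0 by apply/setP => y; rewrite !inE.
  by rewrite cofactor0.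
rewrite rcons_path last_rcons => /andP[pF sB] ->.
have [o [X [sX eC]]] := IH _ pF erefl.
move: sB; rewrite /subfam_rel {}eC; case mC: (minvar _) => [x|//].
have /eqP/minvarP[/bigcupP[T TC xT] xmin] := mC.
have xo : x \notin cut o.
  by move: TC; rewrite in_cofactor => /andP[dT _]; rewrite (disjointFr dT xT).
have so : cut o \subset [set y | (y < x)%O].
  apply/subsetP => y; rewrite !inE => yo; rewrite ltNge; apply: contra xo => xy.
  by rewrite inE; case: (o) yo => // z; apply: le_trans.
have ex : x |: [set y | (y < x)%O] = cut (Some x).
  by apply/setP => y; rewrite !inE le_eqVlt.
have sXx := subset_trans sX so.
(* No member contains an element below the minimal variable [x], so the segment may grow up to [x]
   before the branch on [x]. *)
rewrite (cofactor_widen so); last first.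
  move=> S SC; rewrite disjoint_subset; apply/subsetP => y yS.
  by rewrite !inE -leNgt (xmin S).
rewrite sublo_cofactor subhi_cofactor ?inE ?ltxx // ex.
case/orP => /eqP->; exists (Some x).
  by exists X; split=> //; rewrite -ex subsetU // sXx orbT.
by exists (x |: X); split=> //; rewrite -ex setUS.
Qed.

(** * Size bounds by counting cofactors *)

Lemma Zsize_subfam F : Zsize F = #|{: subfam F}| + 2.
Proof.
rewrite -(Zsize_reduced (can_is_zdd F) (can_reduced F)) //.
exact: can_family (connect0 _ _).
Qed.

(* The cofactors [set0] and [[set set0]] are paid for by the two terminals. *)
Lemma Zsize_ge_cofactors F D : down_closed D ->
  #|[set cofactor D X F | X in powerset D]| <= Zsize F.
Proof.
move=> dD; set K := [set _ | _ in _].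
have sK : K \subset [set set0; [set set0]] :|: [set val A | A : subfam F].
  apply/subsetP => C /imsetP[X]; rewrite inE => sX ->{C}.
  set A := cofactor D X F; rewrite !inE.
  have [//|nz] := eqVneq A set0; case mA: (minvar A) => [x|]; last first.
    by case: (minvarN mA) nz => ->; rewrite ?eqxx.
  have PA : connect (@subfam_rel _ U) F A && minvar A.
    by rewrite cofactor_connect // mA.
  by apply/orP; right; apply/imsetP; exists (Sub A PA).
apply: leq_trans (subset_leq_card sK) _.
rewrite Zsize_subfam addnC; apply: leq_trans (leq_card_setU _ _) _.
by rewrite leq_add ?leq_imset_card // cards2; case: eqP.
Qed.

(** An inner node is a nonempty cofactor. Joining one of its members to [X] gives a member of [F]
    whose trace on the segment is [X], so only such traces matter. *)
Lemma Zsize_le_cofactors F (K : {set {set {set U}}}) :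
  (forall o B, B \in F -> cofactor (cut o) (B :&: cut o) F \in K) ->
  Zsize F <= #|K| + 2.
Proof.
move=> hK; rewrite Zsize_subfam leq_add2r -(card_imset _ val_inj).
apply/subset_leq_card/subsetP => _ /imsetP[[A /= /andP[cA mA]] _ ->].
have [o [X [sX eA]]] := connect_cofactor cA.
have [S SA] : exists S, S \in A.
  case: (minvar A) (@minvarP _ U A) mA => // x /(_ x); rewrite eqxx.
  by case/elimT=> // /bigcupP[S]; exists S.
move: SA; rewrite eA in_cofactor => /andP[dS XS].
suff eX : (X :|: S) :&: cut o = X by rewrite -{1}eX; apply: hK.
by rewrite setIUl (setIidPl sX) (disjoint_setI0 dS) setU0.
Qed.

Lemma Zsize_le_card F : Zsize F <= #|U|.+1 * #|F| + 2.
Proof.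
pose f (p : option U * {set U}) := cofactor (cut p.1) (p.2 :&: cut p.1) F.
have := @Zsize_le_cofactors F (f @: setX setT F).
move/(_ _)/leq_trans; apply.
  by move=> o B BF; apply/imsetP; exists (o, B); rewrite ?inE.
rewrite leq_add2r; apply: leq_trans (leq_imset_card _ _) _.
by rewrite cardsX cardsT card_option.
Qed.

Lemma Zsize_setT : Zsize [set: {set U}] <= #|U|.+1 + 2.
Proof.
have := @Zsize_le_cofactors setT [set powerset (~: cut o) | o in setT].
move/(_ _)/leq_trans; apply.
  move=> o B _; apply/imsetP; exists o => //.
  by apply/setP => S; rewrite !inE andbT.
rewrite leq_add2r; apply: leq_trans (leq_imset_card _ _) _.
by rewrite cardsT card_option.
Qed.

(** If any two choices on [D] are told apart by some completion [S], their cofactors differ. *)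
Lemma Zsize_ge_exp F D : down_closed D ->
  (forall X X', X \subset D -> X' \subset D ->
    (forall S, [disjoint S & D] -> (X :|: S \in F) = (X' :|: S \in F)) ->
    X = X') ->
  2 ^ #|D| <= Zsize F.
Proof.
move=> dD hD; rewrite -card_powerset.
apply: leq_trans (Zsize_ge_cofactors F dD); rewrite card_in_imset //.
move=> X X'; rewrite !inE => sX sX' eXX'; apply: hD => // S dS.
by move/setP/(_ S): eXX'; rewrite !in_cofactor dS.
Qed.

(** Complementing a family keeps the completions that tell two choices apart, so this identity and
    the next reduce the negated operations to restrict and permit. *)
Lemma nonsupersetTE F : nonsuperset setT F = ~: restrict setT F.
Proof.
apply/setP => S; rewrite !inE negb_exists; apply: eq_forallb => B.
by rewrite negb_and implybE.
Qed.

Lemma nonsubsetTE F : nonsubset setT F = ~: permit setT F.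
Proof.
apply/setP => S; rewrite !inE negb_exists; apply: eq_forallb => B.
by rewrite negb_and implybE.
Qed.

End Cofactors.

(** * The pairs and the exponential lower bound *)

Section Pairs.
Variable m : nat.
Local Notation U := 'I_(m + m).
Implicit Types (i : 'I_m) (S X : {set U}).

(** [lshift m i] is $x_i$ and [rshift m i] is $y_i$; the order of ordinals puts every $x_i$ before
    every $y_j$. *)
Definition pair_set i : {set U} := [set lshift m i; rshift m i].
Definition pairs : {set {set U}} := [set pair_set i | i in setT].
Definition copairs : {set {set U}} := [set ~: pair_set i | i in setT].
Definition left_half : {set U} := [set lshift m i | i in setT].

Lemma left_half_rshift i : rshift m i \notin left_half.
Proof. by apply/imsetP => -[j _ /eqP]; rewrite eq_rlshift. Qed.

Lemma card_left_half : #|left_half| = m.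
Proof. by rewrite card_imset ?cardsT ?card_ord //; apply: lshift_inj. Qed.

Lemma left_half_down : down_closed left_half.
Proof.
move=> x y /imsetP[i _ ->] yi.
have ym : y < m by apply: leq_ltn_trans (ltn_ord i); exact: yi.
by apply/imsetP; exists (Ordinal ym) => //; apply: val_inj.
Qed.

(** With $y_i$ as its only right element, the set can contain no pair but the one of index [i]. *)
Lemma mem_restrict_pairs X i : X \subset left_half ->
  (X :|: [set rshift m i] \in restrict setT pairs) = (lshift m i \in X).
Proof.
move=> sX; rewrite !inE /=; apply/exists_inP/idP => [[B /imsetP[j _ ->]]|iX].
  rewrite subUset !sub1set !inE eq_lrshift orbF => /andP[jX /orP[jX'|]].
    by case/negP: (left_half_rshift j); apply: (subsetP sX).
  by move/eqP/rshift_inj => <-.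
exists (pair_set i); first exact: imset_f.
by rewrite subUset !sub1set !inE iX eqxx orbT.
Qed.

(** Lying in the complement of a pair means avoiding the pair. Every right element except $y_i$ is
    present, so only the pair of index [i] can be avoided. *)
Lemma mem_permit_copairs X i : X \subset left_half ->
  (X :|: (~: left_half :\ rshift m i) \in permit setT copairs) =
  (lshift m i \notin X).
Proof.
move=> sX; rewrite !inE /=; apply/exists_inP/idP => [[B /imsetP[j _ ->]]|iX].
  move/subsetP=> sB; have nB y : y \in pair_set j ->
      y \notin X :|: (~: left_half :\ rshift m i).
    by move=> yj; apply/negP => /sB; rewrite inE yj.
  have := nB (rshift m j); rewrite !inE eqxx orbT => /(_ isT).
  rewrite left_half_rshift andbT negb_or negbK => /andP[_ /eqP/rshift_inj <-].
  by have := nB (lshift m j); rewrite !inE eqxx => /(_ isT); case/norP.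
exists (~: pair_set i); first exact: imset_f.
apply/subsetP => y; rewrite !inE negb_or.
case/orP => [yX|/andP[-> ynL]].
  apply/andP; split; first by apply: contraNneq iX => <-.
  by apply: contraTneq (subsetP sX _ yX) => ->; apply: left_half_rshift.
by rewrite andbT; apply: contraNneq ynL => ->; apply: imset_f.
Qed.

Lemma eq_sub_left_half X X' : X \subset left_half -> X' \subset left_half ->
  (forall i, (lshift m i \in X) = (lshift m i \in X')) -> X = X'.
Proof.
move=> sX sX' e; apply/setP => y.
have [/imsetP[i _ ->] //|yL] := boolP (y \in left_half).
by rewrite (negPf (contra (subsetP sX y) yL)) (negPf (contra (subsetP sX' y) yL)).
Qed.

Definition op_arg (op : family_op) :=
  match op with Restrict | Nonsuperset => pairs | _ => copairs end.

Lemma card_op_arg op : #|op_arg op| <= m.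
Proof.
by case: op; apply: leq_trans (leq_imset_card _ _) _; rewrite cardsT card_ord.
Qed.

Lemma Zsize_apply_op op : 2 ^ m <= Zsize (apply_op op setT (op_arg op)).
Proof.
rewrite -[in 2 ^ m]card_left_half; apply: Zsize_ge_exp => [|X X' sX sX' e].
  exact: left_half_down.
have d1 i : [disjoint [set rshift m i] & left_half].
  by rewrite disjoints1 left_half_rshift.
have d2 i : [disjoint ~: left_half :\ rshift m i & left_half].
  by rewrite disjoints_subset subsetDl.
(* Each operation uses one of the two completions to read off whether $x_i$ was chosen. *)
apply: eq_sub_left_half => // i; move: (e _ (d1 i)) (e _ (d2 i)); case: (op) => /=.
- by rewrite !mem_restrict_pairs.
- by rewrite !mem_permit_copairs // => _ /negb_inj.
- rewrite nonsupersetTE !(in_setC _ (restrict _ _)).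
  by rewrite !mem_restrict_pairs // => /negb_inj.
- rewrite nonsubsetTE !(in_setC _ (permit _ _)).
  by rewrite !mem_permit_copairs // => _ /negb_inj/negb_inj.
Qed.

End Pairs.

Theorem theorem10 (op : family_op) :
  exists (disp : Order.disp_t) (U : nat -> finOrderType disp)
         (F G : forall m : nat, {set {set U m}}),
    [/\ (exists C m0 : nat, forall m : nat, m0 <= m -> #|U m| <= C * m ^ 2),
        (exists C m0 : nat, forall m : nat, m0 <= m ->
           Zsize (F m) + Zsize (G m) <= C * m ^ 4)
      & (exists (p : {poly rat}) (m0 : nat), forall m : nat, m0 <= m ->
           (0 < p.[m%:R])%R /\
           (2 ^+ m / p.[m%:R] <= (Zsize (apply_op op (F m) (G m)))%:R)%R)].
Proof.
exists _, (fun m => 'I_(m + m) : finOrderType _), (fun m => setT).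
exists (fun m => op_arg m op); split.
- by exists 2, 1 => m m1; rewrite card_ord; nia.
(* The bounds $2m+3$ and $2m^2+m+2$ add up to $2m^2+3m+5$, which equals 10 at $m=1$. *)
- exists 10, 1 => m m1.
  have leF := Zsize_setT 'I_(m + m).
  have leG := leq_trans (Zsize_le_card (op_arg m op))
    (leq_add (leq_mul (leqnn _) (card_op_arg m op)) (leqnn 2)).
  apply: leq_trans (leq_add leF leG) _; rewrite card_ord.
  have -> : (m + m).+1 * m = 2 * m ^ 2 + m by lia.
  have : m ^ 2 <= m ^ 4 by rewrite leq_pexp2l.
  by have : m <= m ^ 2; nia.
(* The lower bound is $2^m$ without polynomial loss, so the constant polynomial 1 serves. *)
- exists 1%R, 0 => m _; rewrite hornerC divr1; split=> //.
  by rewrite -natrX ler_nat; exact: Zsize_apply_op.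
Qed.
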